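(* Let $(P,Q)$ be a quasi-projection pair on a Hilbert $C^*$-module $\mathscr{H}$, and let $$\Sigma=\big\{(A,B): A\in\{P,I-P\},\ B\in\{Q,Q^*,I-Q,I-Q^*\}\big\}.$$ If one element in $\Sigma$ is harmonious, then all the remaining elements in $\Sigma$ are harmonious.
   Context: $\mathfrak{A}$ is a $C^*$-algebra and $\mathscr{H}$ is a (right) Hilbert $\mathfrak{A}$-module; $\mathcal{L}(\mathscr{H})$ is the $C^*$-algebra of adjointable operators on $\mathscr{H}$, and $I$ is the identity operator on $\mathscr{H}$. For $T\in\mathcal{L}(\mathscr{H})$, $\mathcal{R}(T)$ and $T^*$ denote its range and adjoint; the bar denotes norm closure. An idempotent is $Q\in\mathcal{L}(\mathscr{H})$ with $Q^2=Q$; a projection is a self-adjoint idempotent. A closed submodule $\mathscr{M}$ of $\mathscr{H}$ is orthogonally complemented in $\mathscr{H}$ if $\mathscr{H}=\mathscr{M}+\mathscr{M}^\perp$. A quasi-projection pair $(P,Q)$ on $\mathscr{H}$ consists of a projection $P\in\mathcal{L}(\mathscr{H})$ and an idempotent $Q\in\mathcal{L}(\mathscr{H})$ such that $PQ^*P=PQP$, $PQ^*(I-P)=-PQ(I-P)$ and $(I-P)Q^*(I-P)=(I-P)Q(I-P)$; equivalently, $Q^*=(2P-I)Q(2P-I)$. It is known that if $(P,Q)$ is a quasi-projection pair then so is every element of $\Sigma$. A quasi-projection pair $(P,Q)$ is harmonious if both $\overline{\mathcal{R}(PQ(I-P))}$ and $\overline{\mathcal{R}((I-P)QP)}$ are orthogonally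 complemented in $\mathscr{H}$. *)

(* Defs.v *)
From HB Require Import structures.
From mathcomp Require Import all_boot all_order all_algebra.
From mathcomp Require Import complex.
From mathcomp Require Import boolp classical_sets reals topology normedtype.

Set Implicit Arguments.
Unset Strict Implicit.
Unset Printing Implicit Defensive.

Import Order.TTheory GRing.Theory Num.Theory.
Import numFieldNormedType.Exports.

Local Open Scope classical_set_scope.
Local Open Scope ring_scope.

(* C*-algebras over the complex numbers R[i], not assumed unital; hence the
   product [cmul] cannot be MathComp's ring multiplication. *)
HB.mixin Record CompleteNormedModule_isCStarAlgebra (R : realType) A
    of CompleteNormedModule R[i] A := {
  cmul : A -> A -> A;
  cstar : A -> A;
  cmulA : forall a b c, cmul a (cmul b c) = cmul (cmul a b) c;
  cmulDl : forall a b c, cmul (a + b) c = cmul a c + cmul b c;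
  cmulDr : forall a b c, cmul a (b + c) = cmul a b + cmul a c;
  cmulZl : forall (k : R[i]) a b, cmul (k *: a) b = k *: cmul a b;
  cmulZr : forall (k : R[i]) a b, cmul a (k *: b) = k *: cmul a b;
  ler_norm_cmul : forall a b, `|cmul a b| <= `|a| * `|b|;
  cstarK : forall a, cstar (cstar a) = a;
  cstarD : forall a b, cstar (a + b) = cstar a + cstar b;
  cstarZ : forall (k : R[i]) a, cstar (k *: a) = Num.conj k *: cstar a;
  cstarM : forall a b, cstar (cmul a b) = cmul (cstar b) (cstar a);
  norm_cstarM : forall a, `|cmul (cstar a) a| = `|a| ^+ 2
}.

#[short(type="cstarAlgType")]
HB.structure Definition CStarAlgebra (R : realType) :=
  {A of CompleteNormedModule_isCStarAlgebra R A & CompleteNormedModule R[i] A}.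

Definition cpositive (R : realType) (A : cstarAlgType R) (a : A) : Prop :=
  exists b : A, a = cmul (cstar b) b.

(* Right Hilbert A-modules.  The inner product is linear in its second
   argument, and [norm_inner] forces the norm of the underlying Banach space to
   be |x| = |<x, x>|^(1/2), so that completeness is completeness for it. *)
HB.mixin Record CompleteNormedModule_isHilbertModule (R : realType)
    (A : cstarAlgType R) H of CompleteNormedModule R[i] H := {
  ract : H -> A -> H;
  inner : H -> H -> A;
  ractDl : forall x y a, ract (x + y) a = ract x a + ract y a;
  ractDr : forall x a b, ract x (a + b) = ract x a + ract x b;
  ractM : forall x a b, ract x (cmul a b) = ract (ract x a) b;
  ractZl : forall (k : R[i]) x a, ract (k *: x) a = k *: ract x a;
  ractZr : forall (k : R[i]) x a, ract x (k *: a) = k *: ract x a;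
  innerDr : forall x y z, inner x (y + z) = inner x y + inner x z;
  innerZr : forall (k : R[i]) x y, inner x (k *: y) = k *: inner x y;
  inner_ract : forall x y a, inner x (ract y a) = cmul (inner x y) a;
  inner_cstar : forall x y, cstar (inner x y) = inner y x;
  inner_ge0 : forall x, cpositive (inner x x);
  inner_eq0 : forall x, inner x x = 0 -> x = 0;
  norm_inner : forall x, `|x| ^+ 2 = `|inner x x|
}.

#[short(type="hilbertModType")]
HB.structure Definition HilbertModule (R : realType) (A : cstarAlgType R) :=
  {H of CompleteNormedModule_isHilbertModule R A H
      & CompleteNormedModule R[i] H}.

Section InnerTheory.
Variables (R : realType) (A : cstarAlgType R) (H : hilbertModType A).
Implicit Types x y z : H.

Lemma cstarN (a : A) : cstar (- a) = - cstar a.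
Proof. by rewrite -scaleN1r cstarZ rmorphN rmorph1 scaleN1r. Qed.

Lemma innerDl x y z : inner (x + y) z = inner x z + inner y z :> A.
Proof. by rewrite -inner_cstar innerDr cstarD !inner_cstar. Qed.

Lemma innerNr x y : inner x (- y) = - inner x y :> A.
Proof. by rewrite -scaleN1r innerZr scaleN1r. Qed.

Lemma innerNl x y : inner (- x) y = - inner x y :> A.
Proof. by rewrite -inner_cstar innerNr cstarN inner_cstar. Qed.

Lemma inner0r x : inner x 0 = 0 :> A.
Proof. by rewrite -(scale0r (0 : H)) innerZr scale0r. Qed.

Lemma inner0l y : inner 0 y = 0 :> A.
Proof.
by rewrite -inner_cstar inner0r -(scale0r (0 : A)) cstarZ rmorph0 !scale0r.
Qed.

End InnerTheory.

Definition is_adjoint (R : realType) (A : cstarAlgType R) (H : hilbertModType A)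
    (T S : H -> H) : Prop :=
  forall x y : H, inner (T x) y = inner x (S y) :> A.

(* L(H).  No linearity or boundedness is required: as usual, both follow from
   the existence of an adjoint. *)
Record adjointable (R : realType) (A : cstarAlgType R) (H : hilbertModType A) :=
  Adjointable {
    adjointable_fun :> H -> H;
    adjointableP : exists S : H -> H, is_adjoint adjointable_fun S
  }.

Notation "''L' ( H )" := (adjointable H) (at level 0, H at level 99,
  format "''L' ( H )") : type_scope.

HB.instance Definition _ (R : realType) (A : cstarAlgType R)
  (H : hilbertModType A) := gen_eqMixin 'L(H).
HB.instance Definition _ (R : realType) (A : cstarAlgType R)
  (H : hilbertModType A) := gen_choiceMixin 'L(H).

Section AdjointableRing.
Variables (R : realType) (A : cstarAlgType R) (H : hilbertModType A).
Implicit Types S T U : 'L(H).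

Lemma adjointable_ext S T : (forall x, S x = T x) -> S = T.
Proof.
case: S T => [S Sp] [T Tp] /= /funext ST.
by move: Sp Tp; rewrite ST => Sp Tp; congr Adjointable; exact: Prop_irrelevance.
Qed.

Lemma is_adjoint_sym (S T : H -> H) : is_adjoint S T -> is_adjoint T S.
Proof. by move=> ST x y; rewrite -inner_cstar -ST inner_cstar. Qed.

Fact adjointable0P : exists S : H -> H, is_adjoint (fun=> 0 : H) S.
Proof. by exists (fun=> 0) => x y; rewrite inner0l inner0r. Qed.

Fact adjointable1P : exists S : H -> H, is_adjoint (fun x : H => x) S.
Proof. by exists (fun x => x). Qed.

Fact adjointableNP T : exists S : H -> H, is_adjoint (fun x => - T x) S.
Proof.
case: (adjointableP T) => T' TT'.
by exists (fun x => - T' x) => x y; rewrite innerNl innerNr TT'.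
Qed.

Fact adjointableDP S T : exists U : H -> H, is_adjoint (fun x => S x + T x) U.
Proof.
case: (adjointableP S) => S' SS'; case: (adjointableP T) => T' TT'.
by exists (fun x => S' x + T' x) => x y; rewrite innerDl innerDr SS' TT'.
Qed.

Fact adjointableMP S T : exists U : H -> H, is_adjoint (fun x => S (T x)) U.
Proof.
case: (adjointableP S) => S' SS'; case: (adjointableP T) => T' TT'.
by exists (fun x => T' (S' x)) => x y; rewrite SS' TT'.
Qed.

Definition adjointable0 : 'L(H) := Adjointable adjointable0P.
Definition adjointable1 : 'L(H) := Adjointable adjointable1P.
Definition adjointableN T : 'L(H) := Adjointable (adjointableNP T).
Definition adjointableD S T : 'L(H) := Adjointable (adjointableDP S T).
Definition adjointableM S T : 'L(H) := Adjointable (adjointableMP S T).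

Lemma is_adjoint_unique (T : H -> H) (S S' : H -> H) :
  is_adjoint T S -> is_adjoint T S' -> S =1 S'.
Proof.
move=> TS TS' y; apply/eqP; rewrite -subr_eq0; apply/eqP.
apply: (@inner_eq0 R A H); rewrite innerDr innerNr.
by rewrite -TS -TS' subrr.
Qed.

Lemma adjointable_funD T (x y : H) : T (x + y) = T x + T y.
Proof.
case: (adjointableP T) => S TS; apply/eqP; rewrite -subr_eq0; apply/eqP.
suff Tz z : inner (T (x + y) - (T x + T y)) z = 0 :> A.
  exact: (@inner_eq0 R A H).
by rewrite innerDl innerNl innerDl !TS innerDl subrr.
Qed.

Fact adjointable_addA : associative adjointableD.
Proof. by move=> S T U; apply: adjointable_ext => x /=; rewrite addrA. Qed.
Fact adjointable_addC : commutative adjointableD.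
Proof. by move=> S T; apply: adjointable_ext => x /=; rewrite addrC. Qed.
Fact adjointable_add0 : left_id adjointable0 adjointableD.
Proof. by move=> S; apply: adjointable_ext => x /=; rewrite add0r. Qed.
Fact adjointable_addN : left_inverse adjointable0 adjointableN adjointableD.
Proof. by move=> S; apply: adjointable_ext => x /=; rewrite addNr. Qed.

HB.instance Definition _ := GRing.isZmodule.Build 'L(H)
  adjointable_addA adjointable_addC adjointable_add0 adjointable_addN.

Fact adjointable_mulA : associative adjointableM.
Proof. by move=> S T U; apply: adjointable_ext. Qed.
Fact adjointable_mul1 : left_id adjointable1 adjointableM.
Proof. by move=> S; apply: adjointable_ext. Qed.
Fact adjointable_mulr1 : right_id adjointable1 adjointableM.
Proof. by move=> S; apply: adjointable_ext. Qed.
Fact adjointable_mulDl : left_distributive adjointableM +%R.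
Proof. by move=> S T U; apply: adjointable_ext. Qed.
Fact adjointable_mulDr : right_distributive adjointableM +%R.
Proof.
by move=> S T U; apply: adjointable_ext => x /=; rewrite adjointable_funD.
Qed.

(* In L(H), multiplication is composition and 1 is the identity operator. *)
HB.instance Definition _ :=
  GRing.Zmodule_isPzRing.Build 'L(H)
    adjointable_mulA adjointable_mul1 adjointable_mulr1
    adjointable_mulDl adjointable_mulDr.

Fact adjP T : exists S : H -> H, is_adjoint (projT1 (cid (adjointableP T))) S.
Proof. by exists T; apply: is_adjoint_sym; exact: projT2 (cid _). Qed.

Definition adj T : 'L(H) := Adjointable (adjP T).

Lemma adjE T : is_adjoint T (adj T).
Proof. exact: projT2 (cid (adjointableP T)). Qed.

End AdjointableRing.

Section QuasiProjectionPairs.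
Variables (R : realType) (A : cstarAlgType R) (H : hilbertModType A).
Implicit Types (P Q : 'L(H)) (M : set H).

Definition is_idempotent Q : Prop := Q * Q = Q.

Definition is_projection P : Prop := adj P = P /\ is_idempotent P.

Definition quasi_projection_pair P Q : Prop :=
  [/\ is_projection P,
      is_idempotent Q,
      P * adj Q * P = P * Q * P,
      P * adj Q * (1 - P) = - (P * Q * (1 - P)) &
      (1 - P) * adj Q * (1 - P) = (1 - P) * Q * (1 - P)].

Definition orthogonal_compl M : set H :=
  [set y | forall x, M x -> inner x y = 0 :> A].

(* Only ever applied to closed submodules. *)
Definition orthogonally_complemented M : Prop :=
  [set x + y | x in M & y in orthogonal_compl M] = setT.

Definition harmonious P Q : Prop :=
  [/\ quasi_projection_pair P Q,
      orthogonally_complemented (closure (range (P * Q * (1 - P)))) &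
      orthogonally_complemented (closure (range ((1 - P) * Q * P)))].

Definition Sigma P Q : set ('L(H) * 'L(H)) :=
  [set P; 1 - P] `*` [set Q; adj Q; 1 - Q; 1 - adj Q].

End QuasiProjectionPairs.

(* Main.v *)
Require Import Defs.
From mathcomp Require Import all_boot all_order all_algebra.
From mathcomp Require Import boolp classical_sets reals topology normedtype.

Import GRing.Theory.

Local Open Scope classical_set_scope.
Local Open Scope ring_scope.

(** A quasi-projection pair is governed by the symmetry s = 2 P - 1, here
    written P - (1 - P): the three block conditions say exactly that
    Q^* = s Q s (lemma [quasi_projection_pairE]).  This equation is visibly
    stable under each of the three involutions P |-> 1 - P (which replaces s by
    - s), Q |-> Q^* and Q |-> 1 - Q (both because s ^ 2 = 1).

    Moreover each involution changes the two off-diagonal blocks P Q (1 - P) and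
    (1 - P) Q P only by a swap or by a sign.  An additive map and its opposite
    have the same range, so the unordered pair of subspaces whose
    complementability defines harmony never changes.  Since the three involutions
    connect (P, Q) with every element of Sigma, harmony of one element is
    harmony of all. *)

Section Adjoint.
Context {R : realType} {A : cstarAlgType R} {H : hilbertModType A}.
Implicit Types S T : 'L(H).

Lemma adj_unique S T : is_adjoint S T -> adj S = T.
Proof.
by move=> ST; apply: adjointable_ext => x; exact: is_adjoint_unique (adjE S) ST x.
Qed.

Lemma adjK T : adj (adj T) = T.
Proof. exact/adj_unique/is_adjoint_sym/adjE. Qed.

Lemma adj1 : adj (1 : 'L(H)) = 1.
Proof. exact: adj_unique. Qed.

Lemma adjN T : adj (- T) = - adj T.
Proof. by apply: adj_unique => x y /=; rewrite innerNl innerNr adjE. Qed.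

Lemma adjD S T : adj (S + T) = adj S + adj T.
Proof. by apply: adj_unique => x y /=; rewrite innerDl innerDr !adjE. Qed.

Lemma adjB S T : adj (S - T) = adj S - adj T.
Proof. by rewrite adjD adjN. Qed.

Lemma adjM S T : adj (S * T) = adj T * adj S.
Proof. by apply: adj_unique => x y /=; rewrite !adjE. Qed.

Lemma adjointable_funN T (x : H) : T (- x) = - T x.
Proof.
have T0 : T 0 = 0 by apply: (addrI (T 0)); rewrite -adjointable_funD !addr0.
by apply: (addrI (T x)); rewrite -adjointable_funD !subrr.
Qed.

Lemma range_adjointableN T : range (- T : 'L(H)) = range T.
Proof.
by apply/seteqP; split=> _ [x _ <-]; exists (- x) => //=;
  rewrite adjointable_funN ?opprK.
Qed.

End Adjoint.

Section Idempotent.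
Context {S : pzRingType} (p : S).
Hypothesis pp : p * p = p.

Lemma mul_idem_compl : p * (1 - p) = 0.
Proof. by rewrite mulrBr mulr1 pp subrr. Qed.

Lemma mul_compl_idem : (1 - p) * p = 0.
Proof. by rewrite mulrBl mul1r pp subrr. Qed.

Lemma idem_compl : (1 - p) * (1 - p) = 1 - p.
Proof. by rewrite mulrBl mul1r mul_idem_compl subr0. Qed.

Lemma mul_idem_symmetry : p * (p - (1 - p)) = p.
Proof. by rewrite mulrBr mul_idem_compl pp subr0. Qed.

Lemma mul_symmetry_idem : (p - (1 - p)) * p = p.
Proof. by rewrite mulrBl mul_compl_idem pp subr0. Qed.

Lemma mul_compl_symmetry : (1 - p) * (p - (1 - p)) = - (1 - p).
Proof. by rewrite mulrBr mul_compl_idem idem_compl sub0r. Qed.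

Lemma symmetry_sqr : (p - (1 - p)) * (p - (1 - p)) = 1.
Proof.
by rewrite mulrBl mul_idem_symmetry mul_compl_symmetry opprK addrC subrK.
Qed.

Lemma mul_symmetry_compl : (p - (1 - p)) * (1 - p) = - (1 - p).
Proof. by rewrite mulrBl mul_idem_compl idem_compl sub0r. Qed.

Lemma idem_block_sum (x : S) :
  x = p * x * p + p * x * (1 - p) + ((1 - p) * x * p + (1 - p) * x * (1 - p)).
Proof.
have pq : p + (1 - p) = 1 by rewrite addrC subrK.
by rewrite -!mulrDr pq !mulr1 -mulrDl pq mul1r.
Qed.

Lemma block_sub1_ur (x : S) : p * (1 - x) * (1 - p) = - (p * x * (1 - p)).
Proof. by rewrite (mulrBr p) mulr1 mulrBl mul_idem_compl sub0r. Qed.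

Lemma block_sub1_ll (x : S) : (1 - p) * (1 - x) * p = - ((1 - p) * x * p).
Proof. by rewrite (mulrBr (1 - p)) mulr1 mulrBl mul_compl_idem sub0r. Qed.

End Idempotent.

Section QuasiProjectionPair.
Context {R : realType} {A : cstarAlgType R} {H : hilbertModType A}.
Implicit Types (P Q : 'L(H)).

(** The missing block condition, obtained by taking adjoints in the condition
    on P Q^* (1 - P). *)
Lemma qpp_block_ll {P Q} : quasi_projection_pair P Q ->
  (1 - P) * adj Q * P = - ((1 - P) * Q * P).
Proof.
move=> [[Pa _] _ _ /(congr1 (@adj _ _ _)) + _].
rewrite adjN !adjM !adjK adjB adj1 Pa !mulrA => ->.
by rewrite opprK.
Qed.

(** Expand both sides into their four blocks with respect to P: the factor
    P - (1 - P) on each side of Q keeps the diagonal blocks and negates the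
    off-diagonal ones. *)
Lemma quasi_projection_pairE P Q : quasi_projection_pair P Q <->
  [/\ is_projection P, is_idempotent Q &
      adj Q = (P - (1 - P)) * Q * (P - (1 - P))].
Proof.
split=> [PQ | [Pp QQ Qs]].
  have ll := qpp_block_ll PQ; case: PQ => Pp QQ ul ur lr; split=> //.
  rewrite [LHS](idem_block_sum P) ul ur ll lr.
  (* With 1 - P abstracted, distributivity leaves the four blocks intact. *)
  move: (1 - P) => P'.
  by rewrite !mulrBl !mulrBr opprB [- _ + _ in LHS]addrC.
have PP := Pp.2; split=> //; rewrite Qs !mulrA.
- by rewrite (mul_idem_symmetry _ PP) -!mulrA (mul_symmetry_idem _ PP).
- by rewrite (mul_idem_symmetry _ PP) -!mulrA (mul_symmetry_compl _ PP) !mulrN.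
- rewrite (mul_compl_symmetry _ PP) -!mulrA (mul_symmetry_compl _ PP).
  by rewrite !mulNr !mulrN opprK.
Qed.

Lemma is_projection_compl P : is_projection P -> is_projection (1 - P).
Proof.
by move=> [Pa PP]; split; [rewrite adjB adj1 Pa | exact: idem_compl].
Qed.

Lemma qpp_compl_l P Q :
  quasi_projection_pair P Q -> quasi_projection_pair (1 - P) Q.
Proof.
move=> /quasi_projection_pairE[Pp QQ Qs]; apply/quasi_projection_pairE.
split=> //; first exact: is_projection_compl.
have -> : 1 - P - (1 - (1 - P)) = - (P - (1 - P)) by rewrite subKr opprB.
by rewrite mulNr mulrN mulNr opprK.
Qed.

Lemma qpp_adj P Q :
  quasi_projection_pair P Q -> quasi_projection_pair P (adj Q).
Proof.
move=> /quasi_projection_pairE[Pp QQ Qs]; apply/quasi_projection_pairE.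
split=> //; first by rewrite /is_idempotent -adjM QQ.
have ss := symmetry_sqr _ Pp.2.
by rewrite adjK Qs !mulrA ss mul1r -mulrA ss mulr1.
Qed.

Lemma qpp_compl_r P Q :
  quasi_projection_pair P Q -> quasi_projection_pair P (1 - Q).
Proof.
move=> /quasi_projection_pairE[Pp QQ Qs]; apply/quasi_projection_pairE.
split=> //; first exact: idem_compl.
move: (P - (1 - P)) (symmetry_sqr _ Pp.2) Qs => s ss Qs.
by rewrite adjB adj1 Qs (mulrBr s 1 Q) mulr1 mulrBl ss.
Qed.

(** Complementing P exchanges the two off-diagonal blocks. *)
Lemma harmonious_compl_l P Q : harmonious P Q -> harmonious (1 - P) Q.
Proof.
by move=> [PQ ur ll]; split; [exact: qpp_compl_l | rewrite subKr..].
Qed.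

Lemma harmonious_adj P Q : harmonious P Q -> harmonious P (adj Q).
Proof.
move=> [PQ ur ll]; split; first exact: qpp_adj.
  by case: PQ => _ _ _ -> _; rewrite range_adjointableN.
by rewrite (qpp_block_ll PQ) range_adjointableN.
Qed.

Lemma harmonious_compl_r P Q : harmonious P Q -> harmonious P (1 - Q).
Proof.
move=> [PQ ur ll]; split; first exact: qpp_compl_r.
  by case: PQ => -[_ PP] _ _ _ _; rewrite block_sub1_ur// range_adjointableN.
by case: PQ => -[_ PP] _ _ _ _; rewrite block_sub1_ll// range_adjointableN.
Qed.

(** Each of the three moves is an involution, hence may be undone. *)
Lemma harmonious_Sigma P Q (S : 'L(H) * 'L(H)) :
  Sigma P Q S -> harmonious S.1 S.2 <-> harmonious P Q.
Proof.
have cl P' Q' : harmonious (1 - P') Q' <-> harmonious P' Q'.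
  split; last exact: harmonious_compl_l.
  by move=> /harmonious_compl_l; rewrite subKr.
have cr P' Q' : harmonious P' (1 - Q') <-> harmonious P' Q'.
  split; last exact: harmonious_compl_r.
  by move=> /harmonious_compl_r; rewrite subKr.
have ad P' Q' : harmonious P' (adj Q') <-> harmonious P' Q'.
  split; last exact: harmonious_adj.
  by move=> /harmonious_adj; rewrite adjK.
by case: S => P' Q' [/= [->|->] [[[->|->]|->]|->]];
  rewrite ?cl ?cr ?ad.
Qed.

End QuasiProjectionPair.

Theorem corollary4p3 (R : realType) (A : cstarAlgType R) (H : hilbertModType A)
    (P Q : 'L(H)) (hPQ : quasi_projection_pair P Q) :
  (exists2 S : 'L(H) * 'L(H), Sigma P Q S & harmonious S.1 S.2) ->
  forall S : 'L(H) * 'L(H), Sigma P Q S -> harmonious S.1 S.2.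
Proof.
by move=> [S0 /harmonious_Sigma S0E /S0E PQh] S /harmonious_Sigma ->.
Qed.
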